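(* Let $P$ be a right-LCM monoid and $P_1$ a submonoid such that the inclusion $P_1\subseteq P$ is closed under factorization and preserves orthogonality. For every Nica-covariant isometric representation $V:P_1\to B(\mathcal{H})$ there exist a Hilbert space $\mathcal{K}\supseteq\mathcal{H}$ and a Nica-covariant isometric representation $W:P\to B(\mathcal{K})$ such that (1) $\mathcal{H}^\perp$ is invariant under $W_p$ for all $p\in P$; (2) $P_{\mathcal{H}}W_p|_{\mathcal{H}}=V_p$ if $p\in P_1$ and $P_{\mathcal{H}}W_p|_{\mathcal{H}}=0$ if $p\notin P_1$, where $P_{\mathcal H}$ is the orthogonal projection onto $\mathcal H$; (3) $\mathcal{H}$ is reducing for $\{W_p:p\in P_1\}$, i.e. for $p\in P_1$, $W_p=\begin{bmatrix}V_p&0\\0&D_p\end{bmatrix}$ with respect to $\mathcal K=\mathcal H\oplus\mathcal H^\perp$, for some $D_p\in B(\mathcal{H}^\perp)$.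
   Context: A monoid $P$ is right-LCM if it is left-cancellative and for all $p,q\in P$ either $pP\cap qP=\emptyset$ or $pP\cap qP=rP$ for some $r\in P$; write $p\vee q=\{r: pP\cap qP=rP\}$. A submonoid $P_1\subseteq P$ is closed under factorization if $xy\in P_1$ ($x,y\in P$) implies $x,y\in P_1$ (then $P_1$ is right-LCM). The inclusion preserves orthogonality if for all $x,y\in P_1$: $xP_1\cap yP_1=\emptyset$ iff $xP\cap yP=\emptyset$. An isometric representation $V$ of a right-LCM monoid $Q$ ($V_e=I$, $V_pV_q=V_{pq}$, $V_p$ isometries) is Nica-covariant if $V_xV_x^*V_yV_y^*=V_rV_r^*$ for $r\in x\vee y$, and $=0$ if $x\vee y=\emptyset$. *)

(* Defs.v *)
From HB Require Import structures.
From mathcomp Require Import all_boot all_order all_algebra.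
From mathcomp Require Import complex.
From mathcomp Require Import Rstruct.
Set Implicit Arguments. Unset Strict Implicit. Unset Printing Implicit Defensive.
Import Order.TTheory GRing.Theory Num.Theory.
Local Open Scope ring_scope.

Notation C := (complex Rdefinitions.R).

Definition ipnorm (V : lmodType C) (ip : V -> V -> C) (x : V) : C :=
  sqrtC (ip x x).

Definition ip_complete (V : lmodType C) (ip : V -> V -> C) : Prop :=
  forall u : nat -> V,
    (forall eps : C, 0 < eps -> exists N : nat, forall m n : nat,
        (N <= m)%nat -> (N <= n)%nat -> ipnorm ip (u m - u n) < eps) ->
    exists l : V, forall eps : C, 0 < eps -> exists N : nat, forall n : nat,
        (N <= n)%nat -> ipnorm ip (u n - l) < eps.

Record hilbert := Hilbert {
  hcar :> lmodType C;
  hip : hcar -> hcar -> C;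
  hip_linear : forall (a : C) (x y z : hcar), hip (a *: x + y) z = a * hip x z + hip y z;
  hip_conj : forall x y : hcar, hip y x = (hip x y)^*;
  hip_ge0 : forall x : hcar, 0 <= hip x x;
  hip_eq0 : forall x : hcar, hip x x = 0 -> x = 0;
  hip_complete : ip_complete hip
}.

Definition is_linear (H K : hilbert) (T : H -> K) : Prop :=
  forall (a : C) (x y : H), T (a *: x + y) = a *: T x + T y.

Definition is_isometry (H K : hilbert) (T : H -> K) : Prop :=
  is_linear T /\ forall x y : H, @hip K (T x) (T y) = @hip H x y.

Definition is_adjoint (H K : hilbert) (T : H -> K) (S : K -> H) : Prop :=
  forall (x : H) (y : K), @hip K (T x) y = @hip H x (S y).

(** Orthogonal complement of the range of the isometric embedding [J : H -> K]
    (i.e. H^perp when H is identified with J(H) inside K). *)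
Definition perp_of (H K : hilbert) (J : H -> K) (k : K) : Prop :=
  forall h : H, @hip K k (J h) = 0.

Definition ideal (P : Type) (mul : P -> P -> P) (S : P -> Prop) (x z : P) : Prop :=
  exists a, S a /\ z = mul x a.

Definition disjoint_ideals (P : Type) (mul : P -> P -> P) (S : P -> Prop) (x y : P) : Prop :=
  ~ exists z, ideal mul S x z /\ ideal mul S y z.

Definition is_join (P : Type) (mul : P -> P -> P) (S : P -> Prop) (x y r : P) : Prop :=
  S r /\ forall z, (ideal mul S x z /\ ideal mul S y z) <-> ideal mul S r z.

Definition fullS (P : Type) : P -> Prop := fun _ => True.

Definition left_cancellative (P : Type) (mul : P -> P -> P) : Prop :=
  forall p x y, mul p x = mul p y -> x = y.

Definition right_LCM (P : Type) (mul : P -> P -> P) : Prop :=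
  left_cancellative mul /\
  forall p q, disjoint_ideals mul (@fullS P) p q \/ exists r, is_join mul (@fullS P) p q r.

Definition closed_under_factorization (P : Type) (mul : P -> P -> P) (P1 : P -> Prop) : Prop :=
  forall x y, P1 (mul x y) -> P1 x /\ P1 y.

Definition preserves_orthogonality (P : Type) (mul : P -> P -> P) (P1 : P -> Prop) : Prop :=
  forall x y, P1 x -> P1 y ->
    (disjoint_ideals mul P1 x y <-> disjoint_ideals mul (@fullS P) x y).

(** Isometric representation of the submonoid S on H (values of V outside S
    are irrelevant). *)
Definition isometric_rep (P : Type) (mul : P -> P -> P) (e : P) (S : P -> Prop)
    (H : hilbert) (V : P -> H -> H) : Prop :=
  (forall h, V e h = h) /\
  (forall p q, S p -> S q -> forall h, V (mul p q) h = V p (V q h)) /\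
  (forall p, S p -> is_isometry (V p)).

(** Nica covariance: V_x V_x^* V_y V_y^* = V_r V_r^* for r ∈ x ∨ y, and = 0 if
    x ∨ y = ∅ (the adjoints exist and are unique). *)
Definition nica_covariant (P : Type) (mul : P -> P -> P) (S : P -> Prop)
    (H : hilbert) (V : P -> H -> H) : Prop :=
  (forall p, S p -> exists A : H -> H, is_adjoint (V p) A) /\
  forall x y, S x -> S y -> forall Ax Ay : H -> H,
    is_adjoint (V x) Ax -> is_adjoint (V y) Ay ->
    (forall r (Ar : H -> H), is_join mul S x y r -> is_adjoint (V r) Ar ->
        forall h, V x (Ax (V y (Ay h))) = V r (Ar h)) /\
    ((~ exists r, is_join mul S x y r) -> forall h, V x (Ax (V y (Ay h))) = 0).

(* Main.v *)
From HB Require Import structures.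
Require Import Defs.
From mathcomp Require Import all_boot all_order all_algebra.
From mathcomp Require Import complex Rstruct boolp functions ring.
From Stdlib Require Reals.
Set Implicit Arguments. Unset Strict Implicit. Unset Printing Implicit Defensive.
Import Order.TTheory GRing.Theory Num.Theory.
Local Open Scope ring_scope.

(** Write [T] for the extension of [V] by zero to [P]. A vector [k] of the
    dilation space is determined by the function [p |-> P_H W_p^* k], and in
    these terms, for [ps = xt] generating [pP /\ xP],
      [(W_x f)(p) = T_s (f t)],  [(W_x^* f)(p) = f (xp)],  [(J h)(p) = T_p^* h].
    On functions with [f (pa) = V_a^* (f p)] for [a] in [P1], these formulas
    satisfy [W_x^* W_y = W_s W_t^*] for [xs = yt] generating [xP /\ yP] (and
    [W_x^* W_y = 0] if this ideal is empty), which contains both the isometry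
    property and Nica covariance. The inner product on the span of the [W_p J h]
    is forced by [<f, W_p J h> = <f p, h>]. It is positive: the range projections
    [W_x W_x^*] commute, so that a sum of [n] terms can be split along them until
    only [<prod (1 - T_d T_d^* ) h, h> >= 0] is left. *)

(** * Linear subsets as modules *)

Section LinearFun.
Variables (Y : lmodType C) (F : Y -> Y).

Definition linear_fun : Prop := forall (a : C) x y, F (a *: x + y) = a *: F x + F y.

Hypothesis lF : linear_fun.

Lemma linear_funB f g : F (f - g) = F f - F g.
Proof. by rewrite addrC -scaleN1r lF scaleN1r addrC. Qed.

Lemma linear_funD f g : F (f + g) = F f + F g.
Proof. by rewrite -[f]scale1r lF !scale1r. Qed.

Lemma linear_fun0 : F 0 = 0.
Proof. by rewrite -(subrr 0) linear_funB !subrr. Qed.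
End LinearFun.

Record linear_subset (V : lmodType C) := LinearSubset {
  lin_mem :> V -> Prop;
  lin_mem0 : lin_mem 0;
  lin_memP : forall (a : C) x y, lin_mem x -> lin_mem y -> lin_mem (a *: x + y) }.

Section Subspace.
Variables (V : lmodType C) (S : linear_subset V).

Lemma lin_memD x y : S x -> S y -> S (x + y).
Proof. by move=> Sx Sy; rewrite -[x]scale1r; apply: lin_memP. Qed.

Lemma lin_memZ a x : S x -> S (a *: x).
Proof. by move=> Sx; rewrite -[_ *: _]addr0; apply: lin_memP => //; apply: lin_mem0. Qed.

Lemma lin_memN x : S x -> S (- x).
Proof. by move=> Sx; rewrite -scaleN1r; apply: lin_memZ. Qed.

Record subspace := Sub { sval : V; svalP : S sval }.

Lemma sval_inj : injective sval.
Proof. by case=> x Sx [y Sy] /= xy; subst y; congr Sub; apply: Prop_irrelevance. Qed.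

HB.instance Definition _ := gen_eqMixin subspace.
HB.instance Definition _ := gen_choiceMixin subspace.

Definition sub0 := Sub (lin_mem0 S).
Definition subD (x y : subspace) := Sub (lin_memD (svalP x) (svalP y)).
Definition subN (x : subspace) := Sub (lin_memN (svalP x)).
Definition subZ a (x : subspace) := Sub (lin_memZ a (svalP x)).

Lemma subDA : associative subD.
Proof. by move=> x y z; apply: sval_inj; apply: addrA. Qed.
Lemma subDC : commutative subD.
Proof. by move=> x y; apply: sval_inj; apply: addrC. Qed.
Lemma sub0D : left_id sub0 subD.
Proof. by move=> x; apply: sval_inj; apply: add0r. Qed.
Lemma subND : left_inverse sub0 subN subD.
Proof. by move=> x; apply: sval_inj; apply: addNr. Qed.
HB.instance Definition _ := GRing.isZmodule.Build subspace subDA subDC sub0D subND.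

Lemma subZA a b x : subZ a (subZ b x) = subZ (a * b) x.
Proof. by apply: sval_inj; apply: scalerA. Qed.
Lemma sub1Z : left_id 1 subZ.
Proof. by move=> x; apply: sval_inj; apply: scale1r. Qed.
Lemma subZDr : right_distributive subZ +%R.
Proof. by move=> a x y; apply: sval_inj; apply: scalerDr. Qed.
Lemma subZDl x : {morph subZ^~ x : a b / a + b}.
Proof. by move=> a b; apply: sval_inj; apply: scalerDl. Qed.
HB.instance Definition _ := GRing.Zmodule_isLmodule.Build C subspace subZA sub1Z subZDr subZDl.

Lemma svalD (x y : subspace) : sval (x + y) = sval x + sval y. Proof. by []. Qed.
Lemma svalZ a (x : subspace) : sval (a *: x) = a *: sval x. Proof. by []. Qed.
Lemma svalN (x : subspace) : sval (- x) = - sval x. Proof. by []. Qed.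
End Subspace.

(** * Limits of complex sequences *)

Definition tends (u : nat -> C) (c : C) : Prop :=
  forall eps : C, 0 < eps -> exists N, forall n, (N <= n)%N -> `|u n - c| < eps.

Lemma tends_cst c : tends (fun=> c) c.
Proof. by move=> eps e0; exists 0%N => n _; rewrite subrr normr0. Qed.

Lemma tends_dominated (u v : nat -> C) (c d : C) (K : C) : 0 <= K ->
  (exists N, forall n, (N <= n)%N -> `|v n - d| <= K * `|u n - c|) ->
  tends u c -> tends v d.
Proof.
move=> K0 [N0 h] uc eps e0.
(* Dividing by [K + 1] covers the case [K = 0]. *)
have [N hN] := uc (eps / (K + 1)) (divr_gt0 e0 (ltr_wpDl K0 ltr01)).
exists (maxn N0 N) => n; rewrite geq_max => /andP[n0 n1].
apply: le_lt_trans (h _ n0) _.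
have /ltW := hN _ n1; move/(ler_wpM2l K0)/le_lt_trans; apply.
rewrite mulrCA -{2}[eps]mulr1 ltr_pM2l // ltr_pdivrMr ?ltr_wpDl //.
by rewrite mul1r ltrDl ltr01.
Qed.

Lemma tendsD u v c d : tends u c -> tends v d -> tends (fun n => u n + v n) (c + d).
Proof.
move=> uc vd eps e0; have e2 : 0 < eps / 2 by rewrite divr_gt0.
have [N hN] := uc _ e2; have [N' hN'] := vd _ e2.
exists (maxn N N') => n; rewrite geq_max => /andP[n0 n1].
rewrite opprD addrACA; apply: le_lt_trans (ler_normD _ _) _.
by rewrite [eps]splitr ltrD ?hN ?hN'.
Qed.

Lemma tendsZ (a : C) u c : tends u c -> tends (fun n => a * u n) (a * c).
Proof.
apply: (tends_dominated (normr_ge0 a)); exists 0%N => n _.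
by rewrite -mulrBr normrM.
Qed.

Lemma tendsN u c : tends u c -> tends (fun n => - u n) (- c).
Proof.
by move=> /(tendsZ (-1)); rewrite mulN1r; under eq_fun do rewrite mulN1r.
Qed.

Lemma tendsB u v c d : tends u c -> tends v d -> tends (fun n => u n - v n) (c - d).
Proof. by move=> uc vd; apply: tendsD => //; apply: tendsN. Qed.

Lemma tends_conj u c : tends u c -> tends (fun n => (u n)^*) c^*.
Proof.
apply: (tends_dominated ler01); exists 0%N => n _.
by rewrite -rmorphB norm_conjC mul1r.
Qed.

Lemma tends_unique u c d : tends u c -> tends u d -> c = d.
Proof.
move=> uc ud; apply/eqP; rewrite -subr_eq0 -normr_eq0; apply/negPn/negP => n0.
have p0 : 0 < `|c - d| by rewrite lt_neqAle eq_sym n0 normr_ge0.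
have [N hN] := tendsB uc ud p0.
by have := hN _ (leqnn N); rewrite subrr sub0r normrN ltxx.
Qed.

Lemma tends_ge0 u c : (exists N, forall n, (N <= n)%N -> 0 <= u n) -> tends u c -> 0 <= c.
Proof.
move=> [N0 u0] uc.
(* In [C], [0 <= c] also says that [c] is real. Both facts are contained in [c = |c|], which passes
   to the limit because [u n = |u n|] eventually. *)
suff -> : c = `|c| by rewrite normr_ge0.
apply: (tends_unique uc); move: (uc); apply: (tends_dominated ler01).
exists N0 => n n0; rewrite mul1r -{1}(ger0_norm (u0 _ n0)).
exact: ler_dist_dist.
Qed.

Definition cauchyC (u : nat -> C) : Prop :=
  forall eps : C, 0 < eps -> exists N, forall m n,
    (N <= m)%N -> (N <= n)%N -> `|u m - u n| < eps.

Lemma RcauchyP (u : nat -> Rdefinitions.R) :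
  (forall eps : Rdefinitions.R, 0 < eps -> exists N, forall m n,
    (N <= m)%N -> (N <= n)%N -> `|u m - u n| < eps) ->
  exists l, forall eps : Rdefinitions.R, 0 < eps ->
    exists N, forall n, (N <= n)%N -> `|u n - l| < eps.
Proof.
move=> h; have hc : Rseries.Cauchy_crit u.
  move=> eps /RltP e0; have [N hN] := h _ e0; exists N => n m n0 m0.
  by apply/RltP; rewrite RdistE hN //; apply/ssrnat.leP.
have [l hl] := Rcomplete.R_complete u hc.
exists l => eps /RltP e0; have [N hN] := hl _ e0; exists N => n n0.
by rewrite -RdistE; apply/RltP; apply: hN; apply/ssrnat.leP.
Qed.

Lemma complete_C u : cauchyC u -> exists c, tends u c.
Proof.
move=> h.
have ReB (x y : C) : complex.Re x - complex.Re y = complex.Re (x - y) by case: x y => ? ? [].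
have ImB (x y : C) : complex.Im x - complex.Im y = complex.Im (x - y) by case: x y => ? ? [].
have lc (x : Rdefinitions.R) : (0 < (x%:C)%C :> C) = (0 < x) by rewrite -ltcR.
(* Multiplication by the imaginary unit preserves the modulus, so bounds on imaginary parts reduce
   to bounds on real parts. *)
have ImRe (z : C) : `|complex.Im z| = `|complex.Re (z * ('i)%C)| by rewrite ReiNIm normrN.
have nRe (z : C) (e : Rdefinitions.R) : `|z| < (e%:C)%C -> `|complex.Re z| < e.
  by move=> ze; rewrite -ltcR; apply: le_lt_trans (normc_ge_Re z) ze.
have nIm (z : C) (e : Rdefinitions.R) : `|z| < (e%:C)%C -> `|complex.Im z| < e.
  move=> ze; rewrite ImRe; apply: nRe; rewrite normrM.
  by rewrite [`|('i)%C|]normc_def /= expr0n /= expr1n add0r sqrtr1 mulr1.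
have [|a ha] := @RcauchyP (fun n => complex.Re (u n)).
  move=> e e0; have [|N hN] := h (e%:C)%C; first by rewrite lc.
  by exists N => m n m0 n0; rewrite ReB; apply/nRe/hN.
have [|b hb] := @RcauchyP (fun n => complex.Im (u n)).
  move=> e e0; have [|N hN] := h (e%:C)%C; first by rewrite lc.
  by exists N => m n m0 n0; rewrite ImB; apply/nIm/hN.
exists (a +i* b)%C => eps e0.
(* A positive element of [C] is real; half of it is allotted to each coordinate. *)
have re : (complex.Re eps)%:C%C = eps by apply: RRe_real; apply: gtr0_real.
have e0' : 0 < complex.Re eps / 2 by rewrite divr_gt0 // -lc re.
have [N hN] := ha _ e0'; have [N' hN'] := hb _ e0'.
exists (maxn N N') => n; rewrite geq_max => /andP[n0 n1].
rewrite -re; set z := u n - _.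
apply: (@le_lt_trans _ _ (`|complex.Re z| + `|complex.Im z|)%:C%C).
  rewrite {1}(complexE z); apply: le_trans (ler_normD _ _) _.
  rewrite normrM [`|('i)%C|]normc_def /= expr0n /= expr1n add0r sqrtr1 mul1r.
  rewrite !normc_def /= expr0n /= !addr0 !sqrtr_sqr.
  by rewrite rmorphD /=.
by rewrite ltcR [complex.Re eps]splitr ltrD // /z -?ReB -?ImB ?hN ?hN'.
Qed.

(** * Completion of a semi-inner product space *)

Record semi_inner (X : lmodType C) (s : X -> X -> C) : Prop := SemiInner {
  si_linear : forall (a : C) x y z, s (a *: x + y) z = a * s x z + s y z;
  si_conj : forall x y, s y x = (s x y)^*;
  si_ge0 : forall x, 0 <= s x x }.

Lemma hip_semi_inner (H : hilbert) : semi_inner (@hip H).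
Proof. by split; [exact: hip_linear|exact: hip_conj|exact: hip_ge0]. Qed.

(** * Cauchy sequences of a semi-inner product and the functionals they represent *)

Section SemiInner.
Variables (X : lmodType C) (s : X -> X -> C) (hs : semi_inner s).

Lemma siDl x y z : s (x + y) z = s x z + s y z.
Proof. by rewrite -[x in LHS]scale1r (si_linear hs) mul1r. Qed.
Lemma si0l z : s 0 z = 0.
Proof. by apply: (addrI (s 0 z)); rewrite -siDl !addr0. Qed.
Lemma siZl a x z : s (a *: x) z = a * s x z.
Proof. by rewrite -[_ *: _]addr0 (si_linear hs) si0l addr0. Qed.
Lemma siNl x z : s (- x) z = - s x z.
Proof. by rewrite -scaleN1r siZl mulN1r. Qed.
Lemma siBl x y z : s (x - y) z = s x z - s y z.
Proof. by rewrite siDl siNl. Qed.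
Lemma siDr x y z : s z (x + y) = s z x + s z y.
Proof. by rewrite (si_conj hs) siDl rmorphD /= -!(si_conj hs). Qed.
Lemma siZr a x z : s z (a *: x) = a^* * s z x.
Proof. by rewrite (si_conj hs) siZl rmorphM /= -!(si_conj hs). Qed.
Lemma siNr x z : s z (- x) = - s z x.
Proof. by rewrite (si_conj hs) siNl rmorphN /= -!(si_conj hs). Qed.
Lemma siBr x y z : s z (x - y) = s z x - s z y.
Proof. by rewrite siDr siNr. Qed.
Lemma si0r z : s z 0 = 0.
Proof. by rewrite (si_conj hs) si0l rmorph0. Qed.

(** The two sides differ by [s (x - y) (x - y)]. This replaces the triangle inequality and lets the
    estimates stay with squared seminorms. *)
Lemma si_parallelogram x y : s (x + y) (x + y) <= 2 * s x x + 2 * s y y.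
Proof.
rewrite -subr_ge0; apply: le_trans (si_ge0 hs (x - y)) _.
rewrite !(siDl, siDr, siNl, siNr) le_eqVlt; apply/orP; left; apply/eqP; ring.
Qed.

Lemma si_tri x y z : s (x - z) (x - z) <= 2 * s (x - y) (x - y) + 2 * s (y - z) (y - z).
Proof. by rewrite -[x - z](subrKA y); apply: si_parallelogram. Qed.

Lemma si_distC x y : s (x - y) (x - y) = s (y - x) (y - x).
Proof. by rewrite -opprB siNl siNr opprK. Qed.

(** Expand [s] at [x - (t * z) *: y] and take the minimizing [t = (s y y)^-1]. The degenerate case
    [s y y = 0] gets its own [t]. *)
Lemma si_CauchySchwarz x y : `|s x y| ^+ 2 <= s x x * s y y.
Proof.
set z := s x y.
have key (t : C) : 0 <= t -> 0 <= s x x - 2 * t * `|z| ^+ 2 + t ^+ 2 * `|z| ^+ 2 * s y y.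
  move=> t0; apply: le_trans (si_ge0 hs (x - (t * z) *: y)) _.
  rewrite !(siDl, siDr, siNl, siNr, siZl, siZr) (si_conj hs x y) -/z.
  rewrite rmorphM /= (geC0_conj t0) normCK le_eqVlt; apply/orP; left; apply/eqP; ring.
have := si_ge0 hs y; rewrite le_eqVlt => /orP[/eqP y0|y0].
  rewrite -y0 mulr0; apply/negPn/negP => n0.
  have z0 : 0 < `|z| ^+ 2.
    rewrite lt_neqAle exprn_ge0 ?normr_ge0 // andbT; apply/negP => /eqP z0.
    by rewrite -z0 lexx in n0.
  (* Since [s y y = 0], this [t] brings the right side of [key] down to [-1]. *)
  have /key : 0 <= (s x x + 1) / (2 * `|z| ^+ 2).
    by rewrite divr_ge0 ?addr_ge0 ?si_ge0 // mulr_ge0 // ltW.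
  rewrite -y0 mulr0 addr0.
  have -> : 2 * ((s x x + 1) / (2 * `|z| ^+ 2)) * `|z| ^+ 2 = s x x + 1.
    by have := lt0r_neq0 z0; generalize (`|z| ^+ 2) => t tn; field; rewrite tn.
  by rewrite opprD addrA subrr sub0r oppr_ge0 ler10.
have /key : 0 <= (s y y)^-1 by rewrite invr_ge0 ltW.
have yn : s y y != 0 by rewrite gt_eqF.
have -> : s x x - 2 * (s y y)^-1 * `|z| ^+ 2 + (s y y)^-1 ^+ 2 * `|z| ^+ 2 * s y y =
   s x x - `|z| ^+ 2 / s y y by field.
by rewrite subr_ge0 ler_pdivrMr.
Qed.

Lemma si_small x y (a e : C) : 0 < a -> 0 < e -> s y y <= a -> s x x < e ^+ 2 / a -> `|s x y| < e.
Proof.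
move=> a0 e0 ya xe; rewrite -(@ltr_pXn2r _ 2) ?nnegrE ?normr_ge0 ?(ltW e0) //.
apply: le_lt_trans (si_CauchySchwarz x y) _.
apply: le_lt_trans (ler_wpM2l (si_ge0 hs x) ya) _.
by rewrite -ltr_pdivlMr.
Qed.

Lemma si_smallC x y (a e : C) : 0 < a -> 0 < e -> s x x <= a -> s y y < e ^+ 2 / a -> `|s x y| < e.
Proof. by rewrite (si_conj hs y x) norm_conjC; apply: si_small. Qed.

Definition si_cauchy (x : nat -> X) : Prop :=
  forall eps : C, 0 < eps -> exists N, forall m n,
    (N <= m)%N -> (N <= n)%N -> s (x m - x n) (x m - x n) < eps.

Lemma ipnorm_lt (x : X) (eps : C) : 0 < eps -> (ipnorm s x < eps) = (s x x < eps ^+ 2).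
Proof.
move=> e0; have x0 := si_ge0 hs x.
by rewrite -(@ltr_pXn2r _ 2) ?nnegrE ?(ltW e0) ?sqrtC_ge0 // sqrtCK.
Qed.

Lemma si_cauchyP (x : nat -> X) :
  (forall eps : C, 0 < eps -> exists N, forall m n,
    (N <= m)%N -> (N <= n)%N -> ipnorm s (x m - x n) < eps) <-> si_cauchy x.
Proof.
split=> h eps e0.
  have se0 : 0 < sqrtC eps by rewrite sqrtC_gt0.
  have [N hN] := h _ se0; exists N => m n m0 n0.
  by have := hN m n m0 n0; rewrite ipnorm_lt // sqrtCK.
have [N hN] := h _ (exprn_gt0 2 e0); exists N => m n m0 n0.
by rewrite ipnorm_lt // hN.
Qed.

Lemma si_cauchy_bounded x : si_cauchy x ->
  exists a : C, 0 < a /\ exists N, forall n, (N <= n)%N -> s (x n) (x n) <= a.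
Proof.
move=> /(_ 1 ltr01)[N hN]; exists (2 * s (x N) (x N) + 2); split.
  by rewrite ltr_wpDl // mulr_ge0 // si_ge0.
exists N => n n0; rewrite addrC -[x n](subrK (x N)).
apply: le_trans (si_parallelogram _ _) _.
by rewrite lerD2r -{2}[2]mulr1 ler_wpM2l // ltW // hN.
Qed.

Lemma si_cauchy_lin (a : C) x y : si_cauchy x -> si_cauchy y ->
  si_cauchy (fun n => a *: x n + y n).
Proof.
move=> cx cy eps e0.
(* The factor 2 comes from [si_parallelogram]; the [+ 1] keeps the divisor positive when [a = 0]. *)
have p0 : 0 < 2 * (a * a^*) + 1 by rewrite ltr_wpDl // mulr_ge0 // mul_conjC_ge0.
have e1 : 0 < eps / 2 / (2 * (a * a^*) + 1) by rewrite !divr_gt0.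
have e2 : 0 < eps / 4 by rewrite divr_gt0 // ltr0n.
have [N hN] := cx _ e1; have [N' hN'] := cy _ e2.
exists (maxn N N') => m n; rewrite !geq_max => /andP[m0 m1] /andP[n0 n1].
have -> : a *: x m + y m - (a *: x n + y n) = a *: (x m - x n) + (y m - y n).
  by rewrite opprD addrACA scalerBr.
apply: le_lt_trans (si_parallelogram _ _) _; rewrite siZl siZr.
rewrite [eps]splitr ltrD //; last first.
  have -> : eps / 2 = 2 * (eps / 4) by field.
  by rewrite ltr_pM2l // hN'.
have := hN _ _ m0 n0; rewrite ltr_pdivlMr //; apply: le_lt_trans.
rewrite mulrDr mulr1 ler_wpDr ?si_ge0 // le_eqVlt; apply/orP; left; apply/eqP; ring.
Qed.

Lemma si_cauchy_tends x y : si_cauchy x -> si_cauchy y -> exists c, tends (fun n => s (x n) (y n)) c.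
Proof.
move=> cx cy; apply: complete_C => eps e0.
have [a [a0 [N hN]]] := si_cauchy_bounded cx.
have [b [b0 [N' hN']]] := si_cauchy_bounded cy.
have e2 : 0 < eps / 2 by rewrite divr_gt0.
have [M hM] := cx _ (divr_gt0 (exprn_gt0 2 e2) b0).
have [M' hM'] := cy _ (divr_gt0 (exprn_gt0 2 e2) a0).
exists (maxn (maxn N N') (maxn M M')) => m n.
rewrite !geq_max => /andP[/andP[m1 m2] /andP[m3 m4]] /andP[/andP[n1 n2] /andP[n3 n4]].
have -> : s (x m) (y m) - s (x n) (y n) = s (x m - x n) (y m) + s (x n) (y m - y n).
  by rewrite siBl siBr subrKA.
apply: le_lt_trans (ler_normD _ _) _; rewrite [eps]splitr ltrD //.
  by apply: (si_small b0) => //; [apply: hN'|apply: hM].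
by apply: (si_smallC a0) => //; [apply: hN|apply: hM'].
Qed.

Lemma si_null_tends x y : tends (fun n => s (x n) (x n)) 0 -> si_cauchy y ->
  tends (fun n => s (x n) (y n)) 0.
Proof.
move=> x0 /si_cauchy_bounded[b [b0 [N' hN']]] eps e0.
have [N hN] := x0 _ (divr_gt0 (exprn_gt0 2 e0) b0).
exists (maxn N N') => n; rewrite geq_max => /andP[n0 n1].
rewrite subr0; apply: (si_small b0) => //; first exact: hN'.
by have := hN _ n0; rewrite subr0 ger0_norm ?si_ge0.
Qed.

(** Split [s (x n) (x n)] as [s (x n) (x n - x m) + s (x n) (x m)] with [m] large and fixed: the
    first term is small because [x] is Cauchy and bounded, the second by weak convergence. *)
Lemma si_weak_null x : si_cauchy x -> (forall y, tends (fun n => s (x n) y) 0) ->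
  tends (fun n => s (x n) (x n)) 0.
Proof.
move=> cx x0 eps e0.
have [a [a0 [N hN]]] := si_cauchy_bounded cx.
have e2 : 0 < eps / 2 by rewrite divr_gt0.
have [M hM] := cx _ (divr_gt0 (exprn_gt0 2 e2) a0).
have [M' hM'] := x0 (x (maxn N M)) _ e2.
exists (maxn (maxn N M) M') => n; rewrite !geq_max => /andP[/andP[n1 n2] n3].
rewrite subr0 -{2}[x n](subrK (x (maxn N M))) siDr.
apply: le_lt_trans (ler_normD _ _) _; rewrite [eps]splitr ltrD //.
  apply: (si_smallC a0) => //; first exact: hN.
  by apply: hM => //; apply: leq_maxr.
by have := hM' _ n3; rewrite subr0.
Qed.

(** Values are taken in the regular module [C^o] so that functionals form a [C]-module pointwise. *)
Definition si_repr (x : nat -> X) (phi : X -> C^o) : Prop :=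
  si_cauchy x /\ forall y, tends (fun n => s (x n) y) (phi y).

Lemma si_repr_lin (a : C) x y (phi psi : X -> C^o) : si_repr x phi -> si_repr y psi ->
  si_repr (fun n => a *: x n + y n) (a *: phi + psi).
Proof.
move=> [cx hx] [cy hy]; split; first exact: si_cauchy_lin.
move=> z; have -> : (fun n => s (a *: x n + y n) z) = (fun n => a * s (x n) z + s (y n) z).
  by apply: funext => n; rewrite (si_linear hs).
by have H := tendsD (@tendsZ a _ _ (hx z)) (hy z); exact H.
Qed.

Lemma si_repr_cst x : si_repr (fun=> x) (s x).
Proof.
split; last by move=> y; apply: tends_cst.
by move=> e e0; exists 0%N => m n _ _; rewrite subrr si0l.
Qed.

(** Two sequences representing one functional differ by a weakly null Cauchy sequence, which is null
    by [si_weak_null]. Hence the inner product of functionals does not depend on the chosen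
    sequences. *)
Lemma si_repr_tends x x' y y' phi psi c : si_repr x phi -> si_repr x' phi ->
  si_repr y psi -> si_repr y' psi ->
  tends (fun n => s (x' n) (y' n)) c -> tends (fun n => s (x n) (y n)) c.
Proof.
have null u u' f : si_repr u f -> si_repr u' f ->
    tends (fun n => s (u n - u' n) (u n - u' n)) 0.
  move=> uf u'f.
  have E : (fun n => -1 *: u' n + u n) = (fun n => u n - u' n).
    by apply: funext => n; rewrite scaleN1r addrC.
  have := si_repr_lin (-1) u'f uf; rewrite E scaleN1r addNr => -[cd hd].
  exact: si_weak_null.
move=> xf x'f yg y'g x'y'.
have h1 := si_null_tends (null _ _ _ xf x'f) yg.1.
have h2 := tends_conj (si_null_tends (null _ _ _ yg y'g) x'f.1).
rewrite rmorph0 in h2; have := tendsD (tendsD h1 h2) x'y'.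
rewrite addr0 add0r; congr tends; apply: funext => n.
by rewrite -(si_conj hs) siBl siBr subrKA subrK.
Qed.

Lemma si_repr0 : exists x, si_repr x 0.
Proof.
exists (fun=> 0); have := si_repr_cst 0; congr si_repr.
by apply: funext => y; rewrite si0l.
Qed.

Definition completion_set : linear_subset (X -> C^o).
Proof.
exists (fun phi => exists x, si_repr x phi); first exact: si_repr0.
by move=> a phi psi [x hx] [y hy]; exists (fun n => a *: x n + y n); apply: si_repr_lin.
Defined.

(* Conjugate-linear functionals that are pointwise limits of [s (x n)] with [x]
   Cauchy: realizing the completion by functions avoids a quotient. *)
Definition completion_car : lmodType C := subspace completion_set.

Definition seq_of (phi : completion_car) : nat -> X := projT1 (cid (svalP phi)).

Lemma seq_ofP phi : si_repr (seq_of phi) (sval phi).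
Proof. exact: projT2 (cid (svalP phi)). Qed.

Definition cip (phi psi : completion_car) : C :=
  projT1 (cid (si_cauchy_tends (seq_ofP phi).1 (seq_ofP psi).1)).

Lemma cip_tends (phi psi : completion_car) x y : si_repr x (sval phi) -> si_repr y (sval psi) ->
  tends (fun n => s (x n) (y n)) (cip phi psi).
Proof.
move=> xf yg; apply: (si_repr_tends xf (seq_ofP phi) yg (seq_ofP psi)).
by rewrite /cip; case: cid.
Qed.

Lemma cip_semi_inner : semi_inner cip.
Proof.
split.
- move=> a f g h.
  have hf := seq_ofP f; have hg := seq_ofP g; have hh := seq_ofP h.
  have hl : si_repr (fun n => a *: seq_of f n + seq_of g n) (sval (a *: f + g)).
    exact: si_repr_lin.
  apply: (tends_unique (cip_tends hl hh)).
  have := tendsD (@tendsZ a _ _ (cip_tends hf hh)) (cip_tends hg hh).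
  by congr tends; apply: funext => n; rewrite (si_linear hs).
- move=> f g; apply: (tends_unique (cip_tends (seq_ofP g) (seq_ofP f))).
  have := tends_conj (cip_tends (seq_ofP f) (seq_ofP g)).
  by congr tends; apply: funext => n; rewrite -(si_conj hs).
- move=> f; apply: tends_ge0 (cip_tends (seq_ofP f) (seq_ofP f)).
  by exists 0%N => n _; apply: si_ge0.
Qed.

Lemma cip_eq0 f : cip f f = 0 -> f = 0.
Proof.
move=> f0; have hf := seq_ofP f; have := cip_tends hf hf; rewrite f0 => n0.
apply: sval_inj; apply: funext => y; apply: (tends_unique (hf.2 y)).
exact: si_null_tends n0 (si_repr_cst y).1.
Qed.

Definition cembed (x : X) : completion_car :=
  @Sub _ completion_set (s x) (ex_intro (fun u => si_repr u (s x)) (fun=> x) (si_repr_cst x)).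

Lemma cembedB x y : cembed (x - y) = cembed x - cembed y.
Proof. by apply: sval_inj; apply: funext => z; rewrite svalD svalN /= siBl. Qed.

Lemma cip_embedl x f : cip (cembed x) f = (sval f x)^*.
Proof.
have hf := seq_ofP f.
apply: (tends_unique (cip_tends (si_repr_cst x : si_repr _ (sval (cembed x))) hf)).
have := tends_conj (hf.2 x); congr tends; apply: funext => n.
by rewrite -(si_conj hs).
Qed.

Lemma cip_embedr x f : cip f (cembed x) = sval f x.
Proof. by rewrite (si_conj cip_semi_inner) cip_embedl conjCK. Qed.

(** The squared distance on the left is the limit of [s (x m - x n) (x m - x n)] in [m], so it
    inherits eventual bounds. *)
Lemma cip_dist_le f x n (e : C) : si_repr x (sval f) ->
  (exists N, forall m, (N <= m)%N -> s (x m - x n) (x m - x n) <= e) ->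
  cip (f - cembed (x n)) (f - cembed (x n)) <= e.
Proof.
move=> hf [N hN]; rewrite -subr_ge0.
have hr : si_repr (fun m => -1 *: x n + x m) (sval (f - cembed (x n))).
  have -> : f - cembed (x n) = -1 *: cembed (x n) + f by rewrite scaleN1r addrC.
  exact: si_repr_lin (si_repr_cst _) hf.
apply: tends_ge0 (tendsB (tends_cst e) (cip_tends hr hr)).
by exists N => m m0; rewrite subr_ge0 scaleN1r addrC hN.
Qed.

End SemiInner.

(** * Completeness, and extension of operators to the completion *)

Section Completion.
Variables (X : lmodType C) (s : X -> X -> C) (hs : semi_inner s).
Local Notation cip := (@cip _ _ hs).
Local Notation cembed := (@cembed _ _ hs).
Local Notation cip_semi_inner := (cip_semi_inner hs).
Local Notation completion_set := (completion_set hs).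
Local Notation completion_car := (completion_car hs).
Local Notation si_repr := (si_repr s).
Local Notation si_cauchy := (si_cauchy s).

Lemma cembed_dense f (eps : C) : 0 < eps ->
  exists x, cip (f - cembed x) (f - cembed x) < eps.
Proof.
move=> e0; have e2 : 0 < eps / 2 by rewrite divr_gt0.
have hf := seq_ofP f; have [N hN] := hf.1 _ e2; exists (seq_of f N).
apply: (@le_lt_trans _ _ (eps / 2)); last by rewrite ltr_pdivrMr // ltr_pMr // ltr1n.
by apply: cip_dist_le => //; exists N => m m0; rewrite ltW // hN.
Qed.

Lemma inv_succ_lt (eps : C) : 0 < eps -> exists N, forall n, (N <= n)%N -> n.+1%:R^-1 < eps.
Proof.
move=> e0; have re : (complex.Re eps)%:C%C = eps by apply/RRe_real/gtr0_real.
have r0 : 0 < complex.Re eps by rewrite -ltcR re.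
exists (Num.bound (complex.Re eps)^-1) => n n0; rewrite invf_plt ?posrE ?ltr0Sn //.
rewrite -re -fmorphV -(rmorph_nat (real_complex Rdefinitions.R)) ltcR.
apply: lt_le_trans (archi_boundP _) _; first by rewrite invr_ge0 ltW.
by rewrite ler_nat; apply: leq_trans n0 _.
Qed.

(** Approximate each [u n] by an embedded vector [z n] with squared distance below [1 / (n + 1)];
    the functional represented by [z] is the limit of [u]. *)
Lemma cip_complete : ip_complete cip.
Proof.
move=> u /(si_cauchyP cip_semi_inner) cu.
have hz n : exists x, cip (u n - cembed x) (u n - cembed x) < n.+1%:R^-1.
  by apply: cembed_dense; rewrite invr_gt0 ltr0Sn.
pose z n := projT1 (cid (hz n)).
have hzn n : cip (u n - cembed (z n)) (u n - cembed (z n)) < n.+1%:R^-1.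
  by rewrite /z; case: cid.
have cz : si_cauchy z.
  (* Two uses of [si_tri] cost [2 + 2 * (2 + 2) = 10] copies of the bound. *)
  move=> eps e0; have e1 : 0 < eps / 10 by rewrite divr_gt0 // ltr0n.
  have [N hN] := inv_succ_lt e1; have [M hM] := cu _ e1.
  exists (maxn N M) => m n; rewrite !geq_max => /andP[m1 m2] /andP[n1 n2].
  have -> : s (z m - z n) (z m - z n) = cip (cembed (z m) - cembed (z n)) (cembed (z m) - cembed (z n)).
    by rewrite -cembedB cip_embedr.
  apply: le_lt_trans (si_tri cip_semi_inner _ (u m) _) _.
  rewrite (si_distC cip_semi_inner).
  have /le_lt_trans := si_tri cip_semi_inner (u m) (u n) (cembed (z n)).
  move=> h; have -> : eps = 2 * (eps / 10) + 2 * (2 * (eps / 10) + 2 * (eps / 10)) by field.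
  rewrite ltrD // ltr_pM2l //; first exact: lt_trans (hzn m) (hN _ m1).
  by apply: h; rewrite ltrD // ltr_pM2l //; [apply: hM|apply: lt_trans (hzn n) (hN _ n1)].
pose f y := projT1 (cid (si_cauchy_tends hs cz (si_repr_cst hs y).1)).
have hf : si_repr z f by split=> // y; rewrite /f; case: cid.
pose F : completion_car := @Sub _ completion_set f (ex_intro (fun u => si_repr u f) z hf).
exists F => eps e0.
have e1 : 0 < eps ^+ 2 / 4 by rewrite divr_gt0 ?exprn_gt0 // ltr0n.
have [N hN] := inv_succ_lt e1; have [M hM] := cz _ e1.
exists (maxn N M) => n; rewrite geq_max => /andP[n0 n1].
rewrite (ipnorm_lt cip_semi_inner) //.
apply: le_lt_trans (si_tri cip_semi_inner _ (cembed (z n)) _) _.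
have -> : eps ^+ 2 = 2 * (eps ^+ 2 / 4) + 2 * (eps ^+ 2 / 4) by field.
apply: ltr_leD; rewrite ?ltr_pM2l ?ler_pM2l //; first exact: lt_trans (hzn n) (hN _ n0).
rewrite (si_distC cip_semi_inner); apply: (@cip_dist_le _ _ hs F z n) => //.
by exists M => m m0; apply/ltW/hM.
Qed.

Lemma completion_linE (a : C) (f g : completion_car) y :
  sval (a *: f + g) y = a * sval f y + sval g y.
Proof. by rewrite svalD svalZ. Qed.

Definition completion : hilbert :=
  Hilbert (si_linear cip_semi_inner) (si_conj cip_semi_inner) (si_ge0 cip_semi_inner)
    (@cip_eq0 _ _ hs) cip_complete.

Definition si_adjoint (A B : X -> X) : Prop := forall x y, s (A x) y = s x (B y).

Definition si_contraction (A : X -> X) : Prop := forall x, s (A x) (A x) <= s x x.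

Section Extension.
Variables (A B : X -> X) (linA : linear_fun A) (AB : si_adjoint A B) (cA : si_contraction A).

(** Because [s (A x) y = s x (B y)], applying [A] to a sequence precomposes its functional with [B];
    contractivity keeps the sequence Cauchy. *)
Lemma si_repr_ext x phi : si_repr x phi -> si_repr (A \o x) (phi \o B).
Proof.
move=> [cx hx]; split; last first.
  move=> y; have := hx (B y); congr tends; apply: funext => n; exact: esym (AB _ _).
move=> e e0; have [N hN] := cx _ e0; exists N => m n m0 n0 /=.
have -> : A (x m) - A (x n) = A (x m - x n).
  by rewrite addrC -scaleN1r -linA scaleN1r addrC.
exact: le_lt_trans (cA _) (hN _ _ m0 n0).
Qed.

Definition extend (f : completion) : completion :=
  @Sub _ completion_set (sval f \o B)
    (ex_intro (fun u => si_repr u (sval f \o B)) _ (si_repr_ext (seq_ofP f))).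

Lemma extend_linear : is_linear extend.
Proof.
move=> a f g; apply: sval_inj; apply: funext => y.
pose u : completion := a *: f + g; pose v : completion := a *: extend f + extend g.
have uE : sval u (B y) = a * sval f (B y) + sval g (B y) := completion_linE a f g (B y).
have vE : sval v y = a * sval (extend f) y + sval (extend g) y.
  exact: completion_linE a (extend f) (extend g) y.
rewrite -/u -/v vE; exact: uE.
Qed.

Lemma cip_extend (f g : completion) x y : si_repr x (sval f) -> si_repr y (sval g) ->
  tends (fun n => s (A (x n)) (y n)) (cip (extend f) g).
Proof.
move=> hf hg; have hr : si_repr (A \o x) (sval (extend f)) by exact: si_repr_ext.
by have h := cip_tends hr hg; exact: h.
Qed.

Lemma extend_embed x : extend (cembed x) = cembed (A x).
Proof. by apply: sval_inj; apply: funext => y; exact: esym (AB _ _). Qed.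
End Extension.

Lemma extend_adjoint A B (lA : linear_fun A) (lB : linear_fun B) (AB : si_adjoint A B) (BA : si_adjoint B A)
  (cA : si_contraction A) (cB : si_contraction B) :
  is_adjoint (extend lA AB cA) (extend lB BA cB).
Proof.
move=> f g; have hf := seq_ofP f; have hg := seq_ofP g.
apply: (tends_unique (cip_extend lA AB cA hf hg)).
have := tends_conj (cip_extend lB BA cB hg hf); rewrite -(si_conj cip_semi_inner).
congr tends; apply: funext => n; by rewrite -(si_conj hs) AB.
Qed.
End Completion.

(** * The dilation *)

Section HilbertFacts.
Variable H : hilbert.
Let hs := hip_semi_inner H.

Lemma hip_ext (h h' : H) : (forall k, hip k h = hip k h') -> h = h'.
Proof.
move=> E; apply/eqP; rewrite -subr_eq0; apply/eqP; apply: hip_eq0.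
by rewrite (siBr hs) E subrr.
Qed.

Lemma adjoint_unique (T S S' : H -> H) : is_adjoint T S -> is_adjoint T S' -> S =1 S'.
Proof. by move=> hS hS' h; apply: hip_ext => k; rewrite -hS -hS'. Qed.

Lemma adjoint_linear (T S : H -> H) : is_adjoint T S -> is_linear S.
Proof.
move=> hS a x y; apply: hip_ext => k.
by rewrite -hS !(siDr hs, siZr hs) !hS.
Qed.
End HilbertFacts.

Section Dilation.
Variables (P : Type) (mul : P -> P -> P) (e : P).
Hypotheses (mulA : associative mul) (mul1p : left_id e mul) (mulp1 : right_id e mul).
Hypothesis hP : right_LCM mul.
Variable P1 : P -> Prop.
Hypotheses (P1e : P1 e) (P1mul : forall x y, P1 x -> P1 y -> P1 (mul x y)).
Hypotheses (hfact : closed_under_factorization mul P1) (horth : preserves_orthogonality mul P1).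
Variables (H : hilbert) (V : P -> H -> H).
Hypotheses (hVrep : isometric_rep mul e P1 V) (hVnica : nica_covariant mul P1 V).

Local Notation "x ** y" := (mul x y) (at level 40, left associativity).
Let hs := hip_semi_inner H.

(** * Least common right multiples in [P] and in [P1] *)

Lemma mulI p x y : p ** x = p ** y -> x = y.
Proof. exact: hP.1. Qed.

(* [p ** s = x ** t] generates the right ideal [pP /\ xP]. *)
Definition joined p x s t : Prop :=
  p ** s = x ** t /\ forall a b, p ** a = x ** b -> exists c, a = s ** c /\ b = t ** c.

Definition orthogonal p x : Prop := forall a b, p ** a <> x ** b.

Lemma joinedC p x s t : joined p x s t -> joined x p t s.
Proof.
move=> [E h]; split=> // a b /esym/h[c [ac bc]].
by exists c.
Qed.

Lemma orthogonalC p x : orthogonal p x -> orthogonal x p.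
Proof. by move=> h a b /esym; apply: h. Qed.

Lemma is_join_joined p x r : is_join mul (@fullS P) p x r ->
  exists s t, r = p ** s /\ joined p x s t.
Proof.
move=> [_ h].
have [|[s [_ rs]] [t [_ rt]]] := (h r).2; first by exists e; rewrite mulp1.
exists s, t; split=> //; split; first by rewrite -rs.
move=> a b ab; have [|c [_ E]] := (h (p ** a)).1.
  by split; [exists a|exists b].
exists c; split; [apply: (@mulI p)|apply: (@mulI x)].
  by rewrite E rs -mulA.
by rewrite -ab E rt -mulA.
Qed.

Lemma joined_or_orthogonal p x : (exists s t, joined p x s t) \/ orthogonal p x.
Proof.
case: (hP.2 p x) => [d|[r /is_join_joined[s [t [_ h]]]]]; last by left; exists s, t.
right=> a b ab; apply: d; exists (p ** a).
by split; [exists a|exists b].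
Qed.

Lemma not_join_orthogonal p x : ~ (exists r, is_join mul (@fullS P) p x r) -> orthogonal p x.
Proof.
move=> nj; case: (hP.2 p x) => // d a b ab; apply: d; exists (p ** a).
by split; [exists a|exists b].
Qed.

(** Preservation of orthogonality yields a common multiple [p ** a = x ** b] with [a] and [b] in
    [P1]. Then [s] and [t] are left factors of [a] and [b], and closure under factorization
    applies. *)
Lemma joined_P1 p x s t : P1 p -> P1 x -> joined p x s t -> P1 s /\ P1 t.
Proof.
move=> p1 x1 [E h].
have : ~ disjoint_ideals mul P1 p x.
  move=> /(horth p1 x1); apply; exists (p ** s).
  by split; [exists s|exists t].
move=> /contrapT[z [[a [a1 za]] [b [b1 zb]]]].
have [|c [ac bc]] := h a b; first by rewrite -za.
by rewrite ac in a1; rewrite bc in b1; split; [case: (hfact a1)|case: (hfact b1)].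
Qed.

(** The quotient [c] found in [P] is a factor of an element of [P1], hence in [P1]. Nica covariance
    of [V] thus becomes available for generators taken in [P]. *)
Lemma joined_is_join p x s t : P1 p -> P1 x -> joined p x s t ->
  is_join mul P1 p x (p ** s).
Proof.
move=> p1 x1 h; have [s1 t1] := joined_P1 p1 x1 h.
case: h => E h; split; first exact: P1mul.
move=> z; split.
  move=> [[a [a1 za]] [b [b1 zb]]].
  have [|c [ac bc]] := h a b; first by rewrite -za.
  exists c; rewrite za ac mulA; split=> //.
  by rewrite ac in a1; case: (hfact a1).
move=> [c [c1 zc]]; split; first by exists (s ** c); rewrite mulA; split=> //; apply: P1mul.
by exists (t ** c); rewrite mulA -E; split=> //; apply: P1mul.
Qed.

(** Joins paste like commuting squares: [p ** s ** s' = x ** t ** s' = x ** y ** t']. *)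
Lemma joined_comp p x y s t s' t' : joined p x s t -> joined t y s' t' ->
  joined p (x ** y) (s ** s') t'.
Proof.
move=> [E h] [E' h']; split; first by rewrite mulA E -mulA E' mulA.
move=> a b; rewrite -mulA => /h[c [ac bc]].
have [d [cd bd]] := h' _ _ (esym bc).
by exists d; rewrite ac cd mulA.
Qed.

Lemma orthogonal_comp p x y : orthogonal p x -> orthogonal p (x ** y).
Proof. by move=> h a b; rewrite -mulA; apply: h. Qed.

Lemma orthogonal_comp2 p x y s t : joined p x s t -> orthogonal t y -> orthogonal p (x ** y).
Proof. by move=> [E h] o a b; rewrite -mulA => /h[c [ac bc]]; apply: (o c b). Qed.

(** * The extension of [V] by zero and its adjoints *)

(* [T], [Ts], [Wfun], [Wsfun], [Jfun] below are T, T^*, W, W^*, J of the header. *)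
Definition T x h : H := if `[< P1 x >] then V x h else 0.

Lemma T_in x h : P1 x -> T x h = V x h.
Proof. by rewrite /T => x1; rewrite asboolT. Qed.

Lemma T_out x h : ~ P1 x -> T x h = 0.
Proof. by rewrite /T => x1; rewrite asboolF. Qed.

Lemma adjoint_T x : exists S, is_adjoint (T x) S.
Proof.
have [x1|x1] := pselect (P1 x).
  by have [S hS] := hVnica.1 x x1; exists S => h k; rewrite T_in // hS.
by exists (fun=> 0) => h k; rewrite T_out // (si0l hs) (si0r hs).
Qed.

Definition Ts x : H -> H := projT1 (cid (adjoint_T x)).

Lemma TsP x : is_adjoint (T x) (Ts x).
Proof. exact: projT2 (cid (adjoint_T x)). Qed.

Lemma adjoint_Ts x h k : hip (Ts x h) k = hip h (T x k).
Proof. by rewrite hip_conj -TsP -hip_conj. Qed.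

Lemma T_linear x : is_linear (T x).
Proof.
move=> a h k; have [x1|x1] := pselect (P1 x); last by rewrite !T_out // scaler0 addr0.
by rewrite !T_in //; apply: (hVrep.2.2 x x1).1.
Qed.

Lemma Ts_linear x : is_linear (Ts x).
Proof. exact: adjoint_linear (@TsP x). Qed.

Lemma T0 x : T x 0 = 0.
Proof. by have := T_linear x (-1) 0 0; rewrite !scaleN1r !addNr. Qed.

Lemma Ts0 x : Ts x 0 = 0.
Proof. by have := Ts_linear x (-1) 0 0; rewrite !scaleN1r !addNr. Qed.

Lemma Ts_out x h : ~ P1 x -> Ts x h = 0.
Proof. by move=> x1; apply: hip_ext => k; rewrite -TsP T_out // (si0l hs) (si0r hs). Qed.

Lemma Te h : T e h = h.
Proof. by rewrite T_in // hVrep.1. Qed.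

Lemma Tse h : Ts e h = h.
Proof. by apply: hip_ext => k; rewrite -TsP Te. Qed.

(** By closure under factorization, [x ** y] lies in [P1] exactly when both factors do, so extending
    by zero keeps multiplicativity. *)
Lemma TM x y h : T (x ** y) h = T x (T y h).
Proof.
have [xy1|xy1] := pselect (P1 (x ** y)).
  by have [x1 y1] := hfact xy1; rewrite !T_in //; apply: hVrep.2.1.
rewrite T_out //; have [x1|x1] := pselect (P1 x); last by rewrite T_out.
by rewrite (@T_out y) ?T0 // => y1; apply: xy1; apply: P1mul.
Qed.

Lemma TsM x y h : Ts (x ** y) h = Ts y (Ts x h).
Proof. by apply: hip_ext => k; rewrite -TsP TM !TsP. Qed.

Lemma TsK x h : P1 x -> Ts x (T x h) = h.
Proof.
move=> x1; apply: hip_ext => k; rewrite -TsP !T_in //.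
exact: (hVrep.2.2 x x1).2.
Qed.

(** [T u] is an isometry, and it is onto since [h = T u (T v h)]; so it is unitary. *)
Lemma T_unitK u v h : u ** v = e -> T u (Ts u h) = h.
Proof.
move=> uv; have u1 : P1 u by case: (@hfact u v) => //; rewrite uv.
by rewrite -{1}[h]Te -uv TM TsK // -TM uv Te.
Qed.

Lemma Ts_adj_V x : P1 x -> is_adjoint (V x) (Ts x).
Proof. by move=> x1 h k; rewrite -TsP T_in. Qed.

(** Apply [Ts a] on the left and [T b] on the right of the Nica relation for [a], [b] to strip the
    outer isometries, reading the join once as [a ** s] and once as [b ** t]. *)
Lemma Ts_T_joined a b s t h : P1 a -> P1 b -> joined a b s t -> Ts a (T b h) = T s (Ts t h).
Proof.
move=> a1 b1 j; have [s1 t1] := joined_P1 a1 b1 j.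
have r1 : P1 (a ** s) by apply: P1mul.
have := (hVnica.2 a b a1 b1 _ _ (Ts_adj_V a1) (Ts_adj_V b1)).1 _ _ (joined_is_join a1 b1 j) (Ts_adj_V r1) (T b h).
rewrite -!T_in // TsK // => E.
by rewrite -(TsK (Ts a _) a1) E TM TsK // j.1 TsM TsK.
Qed.

Lemma Ts_T_orthogonal a b h : P1 a -> P1 b -> orthogonal a b -> Ts a (T b h) = 0.
Proof.
move=> a1 b1 o.
have E : V a (Ts a (V b (Ts b (V b h)))) = 0.
  apply: (hVnica.2 a b a1 b1 _ _ (Ts_adj_V a1) (Ts_adj_V b1)).2.
  move=> [r [r1 hr]]; have [|[s [_ rs]] [t [_ rt]]] := (hr r).2.
    by exists e; rewrite mulp1.
  by apply: (o s t); rewrite -rs.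
by rewrite -(TsK (Ts a _) a1) -(TsK h b1) !T_in // E Ts0.
Qed.

(** * Covariant functions and the operators acting on them *)

Definition covariant (f : P -> H) : Prop := forall p a, P1 a -> f (p ** a) = Ts a (f p).

(** The default [0] is the orthogonal case. The cofactors are picked by choice, which [W_joined]
    shows to be harmless on covariant functions. *)
Definition Wfun x (f : P -> H) (p : P) : H :=
  if pselect (exists st, joined p x st.1 st.2) is left ex
  then let st := projT1 (cid ex) in T st.1 (f st.2) else 0.

Definition Wsfun x (f : P -> H) (p : P) : H := f (x ** p).

Definition Jfun h (p : P) : H := Ts p h.

Lemma W_orthogonal x f p : orthogonal p x -> Wfun x f p = 0.
Proof. by rewrite /Wfun => o; case: pselect => // ex; exfalso; case: ex => -[s t] [/o]. Qed.

(** Two pairs of cofactors differ by a unit [c], which lies in [P1]. Covariance turns [f (t' ** c)]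
    into [Ts c (f t')], and [T c] undoes [Ts c]. *)
Lemma W_joined x f p s t : covariant f -> joined p x s t -> Wfun x f p = T s (f t).
Proof.
rewrite /Wfun => cf j; case: pselect => [ex|]; last by case; exists (s, t).
case: cid => -[s' t'] /= j'.
have [c [sc tc]] := j'.2 _ _ j.1.
have [d [sd td]] := j.2 _ _ j'.1.
have cd : c ** d = e by apply: (@mulI s'); rewrite mulA -sc -sd mulp1.
have c1 : P1 c by case: (@hfact c d) => //; rewrite cd.
by rewrite sc tc cf // TM (T_unitK _ cd).
Qed.

Lemma covariant_J h : covariant (Jfun h).
Proof. by move=> p a a1; rewrite /Jfun TsM. Qed.

Lemma covariant_Ws x f : covariant f -> covariant (Wsfun x f).
Proof. by move=> cf p a a1; rewrite /Wsfun mulA cf. Qed.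

Lemma joined_right p x a s t b c : joined p x s t -> joined a s b c -> joined (p ** a) x b (t ** c).
Proof. by move=> j j'; apply/joinedC/(joined_comp (joinedC j))/joinedC. Qed.

(** [Ts_T_joined] moves [Ts a] past [T s] when [s] is in [P1]. Otherwise both sides vanish: for
    [a ** b = s ** c], having [b] in [P1] would force [s] into [P1]. *)
Lemma covariant_W x f : covariant f -> covariant (Wfun x f).
Proof.
move=> cf p a a1.
case: (joined_or_orthogonal p x) => [[s [t j]]|o]; last first.
  rewrite !W_orthogonal ?Ts0 //.
  exact/orthogonalC/orthogonal_comp/orthogonalC.
rewrite (W_joined cf j).
case: (joined_or_orthogonal a s) => [[b [c j']]|o]; last first.
  rewrite W_orthogonal; last first.
    exact/orthogonalC/(orthogonal_comp2 (joinedC j))/orthogonalC.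
  have [s1|s1] := pselect (P1 s); first by rewrite Ts_T_orthogonal.
  by rewrite T_out // Ts0.
rewrite (W_joined cf (joined_right j j')).
have [s1|s1] := pselect (P1 s).
  by have [b1 c1] := joined_P1 a1 s1 j'; rewrite cf // (Ts_T_joined _ a1 s1 j').
rewrite (@T_out s) // Ts0 T_out // => b1; apply: s1.
by have := P1mul a1 b1; rewrite j'.1 => /hfact[].
Qed.

Lemma W_comp x y f : covariant f -> Wfun (x ** y) f = Wfun x (Wfun y f).
Proof.
move=> cf; apply: funext => p; have cW := covariant_W y cf.
case: (joined_or_orthogonal p x) => [[s [t j]]|o]; last first.
  by rewrite (W_orthogonal _ o) W_orthogonal //; exact: orthogonal_comp o.
rewrite (W_joined cW j).
case: (joined_or_orthogonal t y) => [[b [c j']]|o]; last first.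
  by rewrite (W_orthogonal _ o) T0 W_orthogonal //; exact: orthogonal_comp2 j o.
by rewrite (W_joined cf j') (W_joined cf (joined_comp j j')) TM.
Qed.

(** By pasting, a join [q ** a = s ** b] gives the join of [x ** q] and [y] with cofactors [a] and
    [t ** b], so both sides at [q] are [T a (f (t ** b))]. *)
Lemma Ws_W_joined x y s t f : covariant f -> joined x y s t ->
  Wsfun x (Wfun y f) = Wfun s (Wsfun t f).
Proof.
move=> cf j; apply: funext => q; rewrite /Wsfun.
case: (joined_or_orthogonal q s) => [[a [b j']]|o].
  by rewrite (W_joined cf (joined_right j j')) (W_joined (covariant_Ws t cf) j').
rewrite !W_orthogonal //.
exact/orthogonalC/(orthogonal_comp2 (joinedC j))/orthogonalC.
Qed.

Lemma Ws_W_orthogonal x y f : orthogonal x y -> Wsfun x (Wfun y f) = 0.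
Proof.
move=> o; apply: funext => q; rewrite /Wsfun W_orthogonal //.
exact/orthogonalC/orthogonal_comp/orthogonalC.
Qed.

Lemma Ws_J x h : Wsfun x (Jfun h) = Jfun (Ts x h).
Proof. by apply: funext => q; rewrite /Wsfun /Jfun TsM. Qed.

Lemma joined_e x : joined x e e x.
Proof.
split; first by rewrite mul1p mulp1.
by move=> a b; rewrite mul1p => <-; exists a; rewrite mul1p.
Qed.

Lemma joined_refl x : joined x x e e.
Proof. by split=> // a b /mulI <-; exists a; rewrite mul1p. Qed.

Lemma W_e f : covariant f -> Wfun e f = f.
Proof. by move=> cf; apply: funext => p; rewrite (W_joined cf (joined_e p)) Te. Qed.

Lemma W_at_e x f : covariant f -> Wfun x f e = T x (f e).
Proof. by move=> cf; rewrite (W_joined cf (joinedC (joined_e x))). Qed.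

(** On [P1] a covariant function is determined by its value at [e]. At [q] outside [P1] both sides
    vanish: if [q ** s = x ** t], then [t] in [P1] would force [q] into [P1]. *)
Lemma W_J x h : P1 x -> Wfun x (Jfun h) = Jfun (V x h).
Proof.
move=> x1; have cJ := @covariant_J h; have cW := covariant_W x cJ.
apply: funext => q; have [q1|q1] := pselect (P1 q).
  by rewrite -[q in LHS]mul1p cW // W_at_e // /Jfun Tse T_in.
rewrite {2}/Jfun Ts_out //.
case: (joined_or_orthogonal q x) => [[s [t j]]|o]; last by rewrite W_orthogonal.
rewrite (W_joined cJ j) /Jfun Ts_out ?T0 // => t1; apply: q1.
by have := P1mul x1 t1; rewrite -j.1 => /hfact[].
Qed.

Lemma W_linear x (a : C) f g : Wfun x (a *: f + g) = a *: Wfun x f + Wfun x g.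
Proof.
apply: funext => p; rewrite /Wfun !fctE; case: pselect => [ex|_]; first exact: T_linear.
by rewrite scaler0 addr0.
Qed.

Lemma Ws_linear x (a : C) f g : Wsfun x (a *: f + g) = a *: Wsfun x f + Wsfun x g.
Proof. by []. Qed.

Lemma J_linear (a : C) h k : Jfun (a *: h + k) = a *: Jfun h + Jfun k.
Proof. by apply: funext => p; apply: Ts_linear. Qed.

Lemma W0 x : Wfun x 0 = 0.
Proof. by have := W_linear x (-1) 0 0; rewrite !scaleN1r !addNr. Qed.

Lemma J0 : Jfun 0 = 0.
Proof. by have := J_linear (-1) 0 0; rewrite !scaleN1r !addNr. Qed.

(** * Finite sums of vectors [W_p J h], with scalars absorbed into [h] *)

Definition kernel_sum (l : seq (P * H)) : P -> H := \sum_(q <- l) Wfun q.1 (Jfun q.2).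

Lemma ev_nil : kernel_sum [::] = 0.
Proof. by rewrite /kernel_sum big_nil. Qed.

Lemma ev_cons q l : kernel_sum (q :: l) = Wfun q.1 (Jfun q.2) + kernel_sum l.
Proof. by rewrite /kernel_sum big_cons. Qed.

Lemma W_D x f g : Wfun x (f + g) = Wfun x f + Wfun x g.
Proof. by have := W_linear x 1 f g; rewrite !scale1r. Qed.

(** The size bound serves the induction on the number of terms in [Wcompl_ge0]; terms orthogonal to
    [x] disappear. *)
Lemma Ws_ev x l : exists2 l', (size l' <= size l)%N & Wsfun x (kernel_sum l) = kernel_sum l'.
Proof.
elim: l => [|[y h] l [l' sl E]]; first by exists [::]; rewrite ?ev_nil.
have WsD : Wsfun x (kernel_sum ((y, h) :: l)) = Wsfun x (Wfun y (Jfun h)) + kernel_sum l' by rewrite ev_cons -E.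
rewrite WsD; case: (joined_or_orthogonal x y) => [[s [t j]]|o].
  exists ((s, Ts t h) :: l') => //.
  by rewrite (Ws_W_joined (@covariant_J h) j) Ws_J ev_cons.
by exists l'; [apply: leqW|rewrite Ws_W_orthogonal // add0r].
Qed.

Lemma W_ev x l : Wfun x (kernel_sum l) = kernel_sum [seq (x ** q.1, q.2) | q <- l].
Proof.
elim: l => [|[y h] l IH]; first by rewrite ev_nil W0.
by rewrite ev_cons W_D IH /= ev_cons (W_comp _ _ (@covariant_J h)).
Qed.

Lemma covariant_ev l : covariant (kernel_sum l).
Proof.
elim: l => [|[y h] l IH]; first by rewrite ev_nil => p a _; rewrite Ts0.
rewrite ev_cons => p a a1; rewrite !fctE.
rewrite IH // (covariant_W y (@covariant_J h)) //.
by have := Ts_linear a 1 (Wfun y (Jfun h) p) (kernel_sum l p); rewrite !scale1r => ->.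
Qed.

Lemma ev_linear (a : C) l l' : a *: kernel_sum l + kernel_sum l' = kernel_sum ([seq (q.1, a *: q.2) | q <- l] ++ l').
Proof.
elim: l => [|[y h] l IH]; first by rewrite ev_nil scaler0 add0r.
rewrite /= !ev_cons -IH scalerDr addrA; congr (_ + _ + _) => /=.
by have := W_linear y a (Jfun h) 0; have := J_linear a h 0; rewrite !addr0 J0 W0 !addr0 => -> ->.
Qed.

Definition spanning : linear_subset (P -> H).
Proof.
exists (fun f => exists l, f = kernel_sum l); first by exists [::]; rewrite ev_nil.
by move=> a f g [l ->] [l' ->]; eexists; apply: ev_linear.
Defined.

Definition Xspan : lmodType C := subspace spanning.

Lemma X_covariant (f : Xspan) : covariant (sval f).
Proof. by case: (svalP f) => l ->; apply: covariant_ev. Qed.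

Lemma W_X x (f : Xspan) : spanning (Wfun x (sval f)).
Proof. by case: (svalP f) => l ->; eexists; apply: W_ev. Qed.

Lemma Ws_X x (f : Xspan) : spanning (Wsfun x (sval f)).
Proof. by case: (svalP f) => l ->; have [l' _ ->] := Ws_ev x l; exists l'. Qed.

Lemma ev_J h : kernel_sum [:: (e, h)] = Jfun h.
Proof. by rewrite ev_cons ev_nil addr0 W_e //; apply: covariant_J. Qed.

Lemma J_X h : spanning (Jfun h).
Proof. by exists [:: (e, h)]; rewrite ev_J. Qed.

Definition WX x (f : Xspan) : Xspan := Sub (W_X x f).
Definition WsX x (f : Xspan) : Xspan := Sub (Ws_X x f).
Definition JX h : Xspan := Sub (J_X h).

Lemma WX_linear x : linear_fun (WX x).
Proof. by move=> a f g; apply: sval_inj; apply: W_linear. Qed.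
Lemma WsX_linear x : linear_fun (WsX x).
Proof. by move=> a f g; apply: sval_inj; apply: Ws_linear. Qed.

Lemma WsX_WX_joined x y s t f : joined x y s t -> WsX x (WX y f) = WX s (WsX t f).
Proof. by move=> j; apply: sval_inj; apply: Ws_W_joined => //; apply: X_covariant. Qed.
Lemma WsX_WX_orthogonal x y f : orthogonal x y -> WsX x (WX y f) = 0.
Proof. by move=> o; apply: sval_inj; apply: Ws_W_orthogonal. Qed.
Lemma WX_comp x y f : WX (x ** y) f = WX x (WX y f).
Proof. by apply: sval_inj; apply: W_comp; apply: X_covariant. Qed.
Lemma WsX_comp x y f : WsX (x ** y) f = WsX y (WsX x f).
Proof. by apply: sval_inj; apply: funext => p; rewrite /= /Wsfun mulA. Qed.
Lemma WX_e f : WX e f = f.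
Proof. by apply: sval_inj; apply: W_e; apply: X_covariant. Qed.
Lemma WsX_e f : WsX e f = f.
Proof. by apply: sval_inj; apply: funext => p; rewrite /= /Wsfun mul1p. Qed.
Lemma WXK x f : WsX x (WX x f) = f.
Proof. by rewrite (WsX_WX_joined _ (joined_refl x)) WX_e WsX_e. Qed.
Lemma WsX_JX x h : WsX x (JX h) = JX (Ts x h).
Proof. by apply: sval_inj; apply: Ws_J. Qed.
Lemma WX_JX x h : P1 x -> WX x (JX h) = JX (V x h).
Proof. by move=> x1; apply: sval_inj; apply: W_J. Qed.

(** * The inner product on the span *)

Definition pairing (f : P -> H) (l : seq (P * H)) : C := \sum_(q <- l) hip (f q.1) q.2.

Lemma pairing_linear a f g l : pairing (a *: f + g) l = a * pairing f l + pairing g l.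
Proof.
rewrite /pairing big_distrr -big_split /=; apply: eq_bigr => q _.
exact: hip_linear.
Qed.

(** For [y ** s = x ** t] the two sides are [<T_s T_t^* h, k>] and [<h, T_t T_s^* k>]. *)
Lemma pairing_kernel x y h k : hip (Wfun x (Jfun h) y) k = hip h (Wfun y (Jfun k) x).
Proof.
case: (joined_or_orthogonal y x) => [[s [t j]]|o]; last first.
  by rewrite !W_orthogonal ?(si0l hs) ?(si0r hs) //; apply: orthogonalC.
rewrite (W_joined (@covariant_J h) j) (W_joined (@covariant_J k) (joinedC j)) /Jfun.
by rewrite TsP adjoint_Ts.
Qed.

(** This symmetry also shows that, for [f] in the span, [pairing f l] depends on [l] only through
    [kernel_sum l], so that [xip] is independent of the chosen list. *)
Lemma pairing_ev l l' : pairing (kernel_sum l) l' = (pairing (kernel_sum l') l)^*.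
Proof.
elim: l => [|q l IH].
  rewrite ev_nil /pairing big_nil rmorph0 big1 // => i _; exact: si0l hs _.
have := pairing_linear 1 (Wfun q.1 (Jfun q.2)) (kernel_sum l) l'; rewrite scale1r mul1r ev_cons => ->.
rewrite IH {3}/pairing big_cons rmorphD /=; congr (_ + _).
rewrite -hip_conj /pairing /kernel_sum; elim: l' {IH} => [|q' l' IH].
  by rewrite !big_nil; apply/esym/(si0r hs).
rewrite !big_cons IH pairing_kernel; exact/esym/(siDr hs).
Qed.

Definition kernel_repr (f : Xspan) : seq (P * H) := projT1 (cid (svalP f)).
Lemma repP f : sval f = kernel_sum (kernel_repr f).
Proof. exact: projT2 (cid (svalP f)). Qed.

Definition xip (f g : Xspan) : C := pairing (sval f) (kernel_repr g).

Lemma xip_conj f g : xip g f = (xip f g)^*.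
Proof. by rewrite /xip (repP f) (repP g) pairing_ev. Qed.

Lemma xipE f (g : Xspan) l : sval g = kernel_sum l -> xip f g = pairing (sval f) l.
Proof. by move=> gl; rewrite xip_conj /xip gl pairing_ev conjCK -repP. Qed.

Lemma xip_linear a f g h : xip (a *: f + g) h = a * xip f h + xip g h.
Proof. exact: pairing_linear. Qed.

Lemma xip_JX f h : xip f (JX h) = hip (sval f e) h.
Proof. by rewrite (@xipE _ _ [:: (e, h)]) ?ev_J // /pairing big_seq1. Qed.

(** [W_x] multiplies the indices of a list by [x] on the left, and [Wsfun] evaluates at exactly
    these shifted indices. *)
Lemma WX_adjoint x : si_adjoint xip (WX x) (WsX x).
Proof.
move=> f g; rewrite xip_conj (@xipE g (WX x f) [seq (x ** q.1, q.2) | q <- kernel_repr f]); last first.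
  by rewrite /= repP W_ev.
rewrite [RHS]xip_conj /xip /pairing big_map //.
Qed.

Lemma WsX_adjoint x : si_adjoint xip (WsX x) (WX x).
Proof. by move=> f g; rewrite xip_conj -WX_adjoint -xip_conj. Qed.

Lemma xipDl f g h : xip (f + g) h = xip f h + xip g h.
Proof. by have := xip_linear 1 f g h; rewrite scale1r mul1r. Qed.

Lemma xipBl f g h : xip (f - g) h = xip f h - xip g h.
Proof. by rewrite addrC -scaleN1r xip_linear mulN1r addrC. Qed.

Lemma xipBr f g h : xip h (f - g) = xip h f - xip h g.
Proof. by rewrite xip_conj xipBl rmorphB /= -!xip_conj. Qed.

Lemma xipDr f g h : xip h (f + g) = xip h f + xip h g.
Proof. by rewrite xip_conj xipDl rmorphD /= -!xip_conj. Qed.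

(** * Commuting range projections and positivity of the inner product *)

Definition Wproj d f := WX d (WsX d f).

Lemma Wproj_linear d : linear_fun (Wproj d).
Proof. by move=> a f g; rewrite /Wproj WsX_linear WX_linear. Qed.

Lemma Wproj_joined x y s t f : joined x y s t -> Wproj x (Wproj y f) = Wproj (x ** s) f.
Proof. by move=> j; rewrite /Wproj (WsX_WX_joined _ j) WX_comp j.1 WsX_comp. Qed.

Lemma Wproj_orthogonal x y f : orthogonal x y -> Wproj x (Wproj y f) = 0.
Proof. by move=> o; rewrite /Wproj WsX_WX_orthogonal // (linear_fun0 (@WX_linear x)). Qed.

Lemma Wproj_comm x y f : Wproj x (Wproj y f) = Wproj y (Wproj x f).
Proof.
case: (joined_or_orthogonal x y) => [[s [t j]]|o].
  by rewrite (Wproj_joined _ j) (Wproj_joined _ (joinedC j)) j.1.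
by rewrite !Wproj_orthogonal //; apply: orthogonalC.
Qed.

Lemma Wproj_idem x f : Wproj x (Wproj x f) = Wproj x f.
Proof. by rewrite /Wproj WXK. Qed.

Lemma Wproj_adj x f g : xip (Wproj x f) g = xip f (Wproj x g).
Proof. by rewrite /Wproj WX_adjoint WsX_adjoint. Qed.

(** The product of the commuting projections [1 - W_d W_d^*] over [d] in [D]. *)
Definition Wcompl (D : seq P) f := foldr (fun d g => g - Wproj d g) f D.

Lemma Wcompl_linear D : linear_fun (Wcompl D).
Proof.
elim: D => [|d D IH] a f g //=.
by rewrite IH (Wproj_linear d) opprD addrACA scalerBr.
Qed.

Lemma Wcompl_Wproj D d f : Wcompl D (Wproj d f) = Wproj d (Wcompl D f).
Proof.
elim: D => [|d' D IH] //=.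
by rewrite IH Wproj_comm (linear_funB (@Wproj_linear d)).
Qed.

Lemma Wcompl_adj D f g : xip (Wcompl D f) g = xip f (Wcompl D g).
Proof.
elim: D f g => [|d D IH] f g //=.
by rewrite xipBl Wproj_adj -xipBr IH (linear_funB (@Wcompl_linear D)) Wcompl_Wproj.
Qed.

Lemma Wcompl_idem D f : Wcompl D (Wcompl D f) = Wcompl D f.
Proof.
elim: D f => [|d D IH] f //=.
rewrite (linear_funB (@Wcompl_linear D)) Wcompl_Wproj IH (linear_funB (@Wproj_linear d)) Wproj_idem.
by rewrite subrr subr0.
Qed.

(** For [u ** s = d ** t] one has [W_u^* W_d W_d^* W_u = W_s W_t^* W_t W_s^* = W_s W_s^*]:
    conjugation turns a factor into one of the same kind, or into [1] if [u] and [d] are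
    orthogonal. *)
Lemma Wcompl_conj D u : exists D', forall g, WsX u (Wcompl D (WX u g)) = Wcompl D' g.
Proof.
elim: D => [|d D [D' IH]] /=; first by exists [::] => g; rewrite /= WXK.
(* [Wcompl D] commutes with [Wproj u], hence preserves the range of [WX u]. *)
have E g : Wcompl D (WX u g) = WX u (Wcompl D' g).
  by rewrite -IH -/(Wproj u _) -Wcompl_Wproj /Wproj WXK.
case: (joined_or_orthogonal u d) => [[s [t j]]|o].
  exists (s :: D') => g; rewrite E (linear_funB (@WsX_linear u)) WXK /=.
  by rewrite /Wproj (WsX_WX_joined _ (joinedC j)) (WsX_WX_joined _ j) (WsX_WX_joined _ (joined_refl t)) WX_e WsX_e.
exists D' => g; rewrite E (linear_funB (@WsX_linear u)) WXK.
by rewrite /Wproj WsX_WX_orthogonal // subr0.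
Qed.

Lemma Wproj_at_e d f : sval (Wproj d f) e = T d (Ts d (sval f e)).
Proof.
rewrite /Wproj /= W_at_e; last exact: (X_covariant (WsX d f)).
have [d1|d1] := pselect (P1 d); last by rewrite !T_out.
by rewrite /= /Wsfun mulp1 -{2}[d]mul1p (X_covariant f).
Qed.

(** By [Wproj_at_e], each factor acts on the value at [e] alone, as [1 - T_d T_d^*]. *)
Lemma Wcompl_at_e D f : sval (Wcompl D f) e = sval (Wcompl D (JX (sval f e))) e.
Proof.
elim: D => [|d D IH]; first by rewrite /= /Jfun Tse.
have E g : sval (Wcompl (d :: D) g) e = sval (Wcompl D g) e - sval (Wproj d (Wcompl D g)) e by [].
by rewrite !E !Wproj_at_e IH.
Qed.

(** Positivity of [xip] is still open here, so the argument moves to [H]: the compression [G] is a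
    self-adjoint idempotent, whence [<G h, h> = <G h, G h>]. *)
Lemma Wcompl_JX_ge0 D h : 0 <= xip (Wcompl D (JX h)) (JX h).
Proof.
pose G k : H := sval (Wcompl D (JX k)) e.
have Gsa k k' : hip (G k) k' = hip k (G k').
  by rewrite -xip_JX Wcompl_adj xip_conj xip_JX -hip_conj.
have GG k : G (G k) = G k by rewrite /G -Wcompl_at_e Wcompl_idem.
by rewrite xip_JX -/(G h) -GG Gsa hip_ge0.
Qed.

Lemma JX_linear (a : C) h k : JX (a *: h + k) = a *: JX h + JX k.
Proof. by apply: sval_inj; apply: J_linear. Qed.

Definition kernel_sumX l : Xspan := @Sub _ spanning (kernel_sum l) (ex_intro (fun l' => kernel_sum l = kernel_sum l') l erefl).

Lemma JXD h k : JX (h + k) = JX h + JX k.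
Proof. by rewrite -[h]scale1r JX_linear !scale1r. Qed.

(* Splitting along the range projection [Wproj u] of the first term
   [WX u (JX k)] removes that term: on the range of [Wproj u] it is absorbed by
   the summand at [e] after translating by [WsX u], and on the complement it
   vanishes. *)
Lemma Wcompl_ge0 n D h l : (size l <= n)%N ->
  0 <= xip (Wcompl D (JX h + kernel_sumX l)) (JX h + kernel_sumX l).
Proof.
elim: n D h l => [|n IH] D h [|[u k] l] //= sl.
- by rewrite (_ : kernel_sumX [::] = 0) ?addr0 ?Wcompl_JX_ge0 //; apply: sval_inj; rewrite /= ev_nil.
- by rewrite (_ : kernel_sumX [::] = 0) ?addr0 ?Wcompl_JX_ge0 //; apply: sval_inj; rewrite /= ev_nil.
set f := _ + _; pose f' := JX h + kernel_sumX l; pose z := JX k.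
have Ef : f = WX u z + f'.
  rewrite /f /f' addrCA; congr (_ + _).
  by apply: sval_inj; rewrite /= ev_cons.
have RA : Wproj u (WX u z) = WX u z by rewrite /Wproj WXK.
have fRf : f - Wproj u f = f' - Wproj u f'.
  by rewrite Ef (linear_funD (@Wproj_linear u)) RA opprD addrACA subrr add0r.
have split : Wcompl D f = Wcompl D (Wproj u f) + Wcompl (u :: D) f'.
  rewrite /= -Wcompl_Wproj -(linear_funB (@Wcompl_linear D)) -fRf.
  by rewrite -(linear_funD (@Wcompl_linear D)) addrC subrK.
rewrite split xipDl addr_ge0 //.
  have -> : xip (Wcompl D (Wproj u f)) f = xip (WsX u (Wcompl D (WX u (WsX u f)))) (WsX u f).
    by rewrite -[Wproj u f]Wproj_idem Wcompl_Wproj Wproj_adj WsX_adjoint.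
  (* Translation changes [D] into [D'] and [h] into [Ts u h + k], while the complement enlarges [D]
     to [u :: D]; hence the induction over all [D] and [h]. *)
  have [D' ->] := Wcompl_conj D u.
  have [l' sl' El'] := Ws_ev u l.
  suff -> : WsX u f = JX (Ts u h + k) + kernel_sumX l' by apply: IH; apply: leq_trans sl' sl.
  rewrite Ef (linear_funD (@WsX_linear u)) WXK (linear_funD (@WsX_linear u)) WsX_JX JXD.
  rewrite addrA [JX k + _]addrC; congr (_ + _).
  by apply: sval_inj.
rewrite Ef xipDr (_ : xip _ (WX u z) = 0) ?add0r; first exact: IH.
by rewrite xipBl Wproj_adj RA subrr.
Qed.

Lemma xip_ge0 f : 0 <= xip f f.
Proof.
(* The empty product is the identity, and [h = 0] removes the summand at [e]. *)
have := @Wcompl_ge0 _ [::] 0 (kernel_repr f) (leqnn _).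
have -> : JX 0 + kernel_sumX (kernel_repr f) = f by apply: sval_inj; rewrite svalD /= J0 add0r -repP.
by [].
Qed.

Lemma xip_semi_inner : semi_inner xip.
Proof. split; [exact: xip_linear|exact: xip_conj|exact: xip_ge0]. Qed.

Lemma WX_contraction x : si_contraction xip (WX x).
Proof. by move=> f; rewrite WX_adjoint WXK. Qed.

(** The difference of the two sides is the squared seminorm of [f - Wproj x f]. *)
Lemma WsX_contraction x : si_contraction xip (WsX x).
Proof.
move=> f; rewrite WsX_adjoint -/(Wproj x f) -subr_ge0 -xipBr.
have := xip_ge0 (f - Wproj x f); rewrite [Q in _ <= Q -> _]xipBl Wproj_adj -xipBr.
by rewrite (linear_funB (@Wproj_linear x)) Wproj_idem subrr subr0.
Qed.

(** * The dilation space and its operators *)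

Definition KH : hilbert := completion xip_semi_inner.
Definition WK x : KH -> KH := @extend _ _ xip_semi_inner _ _ (@WX_linear x) (@WX_adjoint x) (@WX_contraction x).
Definition WsK x : KH -> KH := @extend _ _ xip_semi_inner _ _ (@WsX_linear x) (@WsX_adjoint x) (@WsX_contraction x).
Definition JK h : KH := cembed xip_semi_inner (JX h).

(** Operators on [KH] are precompositions, so their identities reduce to those of [WX] and [WsX]
    with the order of composition reversed. *)
Lemma WKE x f y : sval (WK x f) y = sval f (WsX x y). Proof. by []. Qed.
Lemma WsKE x f y : sval (WsK x f) y = sval f (WX x y). Proof. by []. Qed.

Lemma KH_ext (f g : KH) : (forall y, sval f y = sval g y) -> f = g.
Proof. by move=> E; apply: sval_inj; apply: funext. Qed.

Lemma WK_adjoint x : is_adjoint (WK x) (WsK x).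
Proof. exact: extend_adjoint. Qed.

Lemma WsK_WK x f : WsK x (WK x f) = f.
Proof. by apply: KH_ext => y; rewrite WsKE WKE WXK. Qed.

Lemma WK_JK x h : P1 x -> WK x (JK h) = JK (V x h).
Proof. by move=> x1; rewrite /WK /JK extend_embed WX_JX. Qed.

Lemma hip_JK (f : KH) h : hip f (JK h) = sval f (JX h).
Proof. exact: cip_embedr. Qed.

(** [W_x^* J h = J T_x^* h] shows that [W_x^*] maps the copy of [H] into itself. *)
Lemma WK_perp x (f : KH) : perp_of JK f -> perp_of JK (WK x f).
Proof. by move=> pf h; rewrite hip_JK WKE WsX_JX -hip_JK. Qed.

Lemma JK_isometry : is_isometry JK.
Proof.
split=> [a h k|h k].
  by apply: KH_ext => y; rewrite completion_linE /= JX_linear xip_linear.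
by rewrite hip_JK /= xip_JX /= /Jfun Tse.
Qed.

Lemma WK_JK_perp x h : ~ P1 x -> perp_of JK (WK x (JK h)).
Proof.
move=> x1 k; rewrite hip_JK WKE WsX_JX Ts_out // -hip_JK JK_isometry.2.
exact: si0r hs h.
Qed.

Lemma WK_isometric_rep : isometric_rep mul e (@fullS P) WK.
Proof.
split; first by move=> f; apply: KH_ext => y; rewrite WKE WsX_e.
split; first by move=> p q _ _ f; apply: KH_ext => y; rewrite !WKE WsX_comp.
move=> p _; split; first exact: extend_linear.
by move=> f g; rewrite WK_adjoint WsK_WK.
Qed.

Lemma WK_nica : nica_covariant mul (@fullS P) WK.
Proof.
split; first by move=> p _; exists (WsK p); apply: WK_adjoint.
move=> x y _ _ Ax Ay hAx hAy.
have {hAx}Ax' := adjoint_unique hAx (@WK_adjoint x).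
have {hAy}Ay' := adjoint_unique hAy (@WK_adjoint y).
split=> [r Ar /is_join_joined[s [t [-> j]]] hAr f|].
  rewrite (adjoint_unique hAr (@WK_adjoint (x ** s))) Ax' Ay'.
  (* Precomposition leaves [Wproj y (Wproj x z)], in reversed order, which calls for the symmetric
     join. *)
  apply: KH_ext => z; rewrite !(WKE, WsKE) -/(Wproj x z) -/(Wproj y _) -/(Wproj _ z).
  by rewrite (Wproj_joined _ (joinedC j)) -j.1.
move=> /not_join_orthogonal/orthogonalC o f; rewrite Ax' Ay'; apply: KH_ext => z.
rewrite !(WKE, WsKE) -/(Wproj x z) -/(Wproj y _) Wproj_orthogonal //.
(* What remains is that [f], as a limit of functionals [xip (c n)], sends [0] to [0]. *)
have [c [_ h]] := svalP f.
by apply: (tends_unique (h 0)); have := tends_cst 0; congr tends; apply: funext => n; rewrite (si0r xip_semi_inner).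
Qed.
End Dilation.

Theorem mainTheorem4
  (P : Type) (mul : P -> P -> P) (e : P)
  (mulA : associative mul) (mul1p : left_id e mul) (mulp1 : right_id e mul)
  (hP : right_LCM mul)
  (P1 : P -> Prop) (P1e : P1 e) (P1mul : forall x y, P1 x -> P1 y -> P1 (mul x y))
  (hfact : closed_under_factorization mul P1)
  (horth : preserves_orthogonality mul P1)
  (H : hilbert) (V : P -> H -> H)
  (hVrep : isometric_rep mul e P1 V) (hVnica : nica_covariant mul P1 V) :
  exists (K : hilbert) (J : H -> K) (W : P -> K -> K),
    is_isometry J /\
    isometric_rep mul e (@fullS P) W /\ nica_covariant mul (@fullS P) W /\
    (* (1) H^perp is invariant under every W_p *)
    (forall p k, perp_of J k -> perp_of J (W p k)) /\
    (* (2) compression of W_p to H is V_p on P1 and 0 off P1 *)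
    (forall p h, P1 p -> perp_of J (W p (J h) - J (V p h))) /\
    (forall p h, ~ P1 p -> perp_of J (W p (J h))) /\
    (* (3) H is reducing for W_p, p in P1, with W_p|_H = V_p *)
    (forall p, P1 p -> (forall h, W p (J h) = J (V p h)) /\
                       (forall k, perp_of J k -> perp_of J (W p k))).
Proof.
pose VK := WK_JK mulA mul1p mulp1 hP P1e P1mul hfact horth hVrep hVnica.
exists (KH mulA mul1p mulp1 hP P1e P1mul hfact horth hVrep hVnica).
exists (JK mulA mul1p mulp1 hP P1e P1mul hfact horth hVrep hVnica).
exists (WK (hVnica := hVnica)).
split; first exact: JK_isometry.
split; first exact: WK_isometric_rep.
split; first exact: WK_nica.
split; first by move=> p k; apply: WK_perp.
split.
  move=> p h p1 k; rewrite (VK p h p1) subrr; exact: si0l (hip_semi_inner _) _.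
split; first by move=> p h; apply: WK_JK_perp.
by move=> p p1; split=> [h|k]; [apply: VK|apply: WK_perp].
Qed.
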